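(* Let $r\geq 2$, $0<c\leq 1/2$, let $H$ be a graph with vertex set $\{v_1,\ldots,v_r\}$, and let $G$ be a graph of order $n$. If $M\subset H(G)$ and $|M|\geq cn^{r}$, then $M$ covers an induced subgraph of $G$ of type $H(s,\ldots,s,t)$ with $s=\lfloor c^{r^{2}}\ln n\rfloor$ and $t$ an integer with $t>n^{1-c^{r-1}}$.
   Context: $H(G)$ is the set of injections $h:V(H)\to V(G)$ such that for all distinct $u,v\in V(H)$, $\{u,v\}\in E(H)$ if and only if $\{h(u),h(v)\}\in E(G)$. For a graph $H$ with vertices $v_1,\ldots,v_r$ and positive integers $x_1,\ldots,x_r$, $H(x_1,\ldots,x_r)$ denotes the graph obtained by replacing each vertex $v_i$ with a set $V_{v_i}$ of $x_i$ vertices (pairwise disjoint, each independent) and each edge $v_iv_j\in E(H)$ with a complete bipartite graph between $V_{v_i}$ and $V_{v_j}$. A graph is of type $H(x_1,\ldots,x_r)$ if it is obtained from $H(x_1,\ldots,x_r)$ by adding some edges within the sets $V_{v_i}$; in $H(s,\ldots,s,t)$ the classes of $v_1,\ldots,v_{r-1}$ have size $s$ and that of $v_r$ has size $t$. Let $Y$ be a subgraph of $G$ of type $H(s_1,\ldots,s_r)$ with designated vertex classes, and let $s=\min\{s_1,\ldots,s_r\}$. A set $M\subset H(G)$ covers $Y$ if: (a) for every edge $ij$ of $Y$ joining two different vertex classes of $Y$, there exist $h\in M$ and an edge $uv\in E(H)$ with $\{h(u),h(v)\}=\{i,j\}$; and (b) there exist $h_1,\ldots,h_s\in M$ such that the images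 $h_i(V(H))$ are pairwise disjoint for $i\neq j$ and, for every $i\in[s]$, $h_i(V(H))$ intersects every vertex class of $Y$. $\ln$ is the natural logarithm. *)

(* Defs.v *)
From HB Require Import structures.
From mathcomp Require Import all_boot all_order all_algebra.
From mathcomp Require Import all_classical all_reals all_analysis.
Set Implicit Arguments. Unset Strict Implicit. Unset Printing Implicit Defensive.
Import Order.TTheory GRing.Theory Num.Theory.

(* Graphs are given by a symmetric irreflexive relation on a finite vertex type.
   H has vertex set 'I_r (v_1,...,v_r are the ordinals 0..r-1). *)

Definition ind_emb (r : nat) (V : finType) (eH : rel 'I_r) (eG : rel V)
  (h : {ffun 'I_r -> V}) : bool :=
  injectiveb h && [forall u, forall v, (u != v) ==> (eH u v == eG (h u) (h v))].

Definition HG (r : nat) (V : finType) (eH : rel 'I_r) (eG : rel V)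
  : {set {ffun 'I_r -> V}} := [set h | ind_emb eH eG h].

(* X : designated vertex classes (X i = V_{v_i}) of sizes sz i; the subgraph
   of G induced on the union of the classes is of type H(sz 0,...,sz (r-1)):
   classes pairwise disjoint, and between different classes x in X i, y in X j,
   xy is an edge of G iff v_i v_j is an edge of H (edges inside classes are
   arbitrary). *)
Definition induced_of_type (r : nat) (V : finType) (eH : rel 'I_r) (eG : rel V)
  (X : 'I_r -> {set V}) (sz : 'I_r -> nat) : Prop :=
  (forall i, #|X i| = sz i) /\
  (forall i j, i != j -> [disjoint X i & X j]) /\
  (forall i j, i != j -> forall x y, x \in X i -> y \in X j -> eG x y = eH i j).

(* minimum class size (the default #|V| is irrelevant for r >= 1, since every
   class has at most #|V| elements) *)
Definition min_class (r : nat) (V : finType) (X : 'I_r -> {set V}) : nat :=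
  \big[minn/#|V|]_(i < r) #|X i|.

Definition covers (r : nat) (V : finType) (eH : rel 'I_r) (eG : rel V)
  (M : {set {ffun 'I_r -> V}}) (X : 'I_r -> {set V}) : Prop :=
  (forall i j, i != j -> forall x y, x \in X i -> y \in X j -> eG x y ->
     exists2 h, h \in M & exists u v, eH u v /\
       ((h u = x /\ h v = y) \/ (h u = y /\ h v = x))) /\
  (exists hs : 'I_(min_class X) -> {ffun 'I_r -> V},
     (forall k, hs k \in M) /\
     (forall k k', k != k' -> [disjoint codom (hs k) & codom (hs k')]) /\
     (forall k i, exists u, hs k u \in X i)).

(* Main.v *)
Require Import Defs.
From HB Require Import structures.
From mathcomp Require Import all_boot all_order all_algebra.
From mathcomp Require Import all_classical all_reals all_analysis.
From mathcomp Require Import lra zify ring.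
Import Order.TTheory GRing.Theory Num.Theory.
Local Open Scope ring_scope.

(* Induction on r, looking for a "grid": m tuples of M, disjoint when M consists
   of injections, such that any two of their entries with different indices
   lie in a common tuple of M.  Many prefixes of length r - 1 extend to M in
   at least (3/4)cn ways; they contain a grid of size m', and a positive
   proportion of the vertices extend at least (c/2)m' of its tuples.  As m' is a
   small multiple of ln n, the 2^m' possible sets of extended tuples number at
   most a small power of n, so by pigeonhole a set T of nearly n vertices
   extends the same (c/2)m' tuples.  These tuples and T supply the first r - 1
   classes and the last class respectively. *)

(** * Averaging and pigeonhole *)

(** Rows below the threshold contribute less than [x * #|B|] each, the others at most [#|B|]. *)
Lemma many_popular (R : realFieldType) (A B : finType) (E : A -> B -> bool)
  (x y : R) :
  (0 < #|B|)%N -> 0 <= x ->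
  (x + y) * #|A|%:R * #|B|%:R <= (\sum_(i : A) #|[set j | E i j]|)%:R ->
  y * #|A|%:R <= #|[set i | x * #|B|%:R <= #|[set j | E i j]|%:R]|%:R.
Proof.
move=> B0 x0 hE; set L := [set i | _].
have B0' : 0 < #|B|%:R :> R by rewrite ltr0n.
rewrite -(ler_pM2r B0') -(lerD2l (x * #|A|%:R * #|B|%:R)) -!mulrDl.
apply: (le_trans hE); rewrite natr_sum.
apply: (@le_trans _ _ (\sum_(i : A) (x * #|B|%:R + (i \in L)%:R * #|B|%:R))).
  apply: ler_sum => i _; rewrite inE.
  case: (leP (x * #|B|%:R) #|[set j | E i j]|%:R) => h /=.
    by rewrite mulr1n mul1r ler_wpDl ?mulr_ge0 ?ler0n // ler_nat max_card.
  by rewrite mulr0n mul0r addr0 ltW.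
rewrite big_split /= sumr_const -mulr_suml -natr_sum.
rewrite -[X in X + _ <= _]mulr_natr mulrAC -mulrDl ler_wpM2r ?ler0n //.
rewrite lerD2l ler_nat -sum1_card [leqRHS]big_mkcond /=.
by apply: leq_sum => i _; case: (i \in L).
Qed.

Lemma pigeonhole (A B : finType) (f : A -> B) (U : {set A}) :
  (0 < #|U|)%N ->
  exists b, (#|U| <= #|B| * #|[set a in U | f a == b]|)%N /\
    (0 < #|[set a in U | f a == b]|)%N.
Proof.
move=> U0; have [u0 u0U] := card_gt0P U0.
have [b hb] : exists b, (#|U| <= #|B| * #|[set a in U | f a == b]|)%N.
  pose F b := #|[set a in U | f a == b]|.
  exists [arg max_(b > f u0) F b].
  case: arg_maxnP => // b _ bmax.
  rewrite -sum1_card (partition_big f predT) //= -sum_nat_const.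
  apply: leq_sum => b' _; rewrite (leq_trans _ (bmax b' _)) //.
  by rewrite sum1dep_card /F; apply: eq_leq; apply: eq_card => a; rewrite !inE.
exists b; split=> //; case: posnP hb => // ->; by rewrite muln0 leqNgt U0.
Qed.

(** * Extending tuples by a last entry; grids and fans *)

Section Extension.
Variables (V : finType) (r : nat).
Implicit Types (g : {ffun 'I_r -> V}) (h : {ffun 'I_r.+1 -> V}).

Definition extend g (v : V) : {ffun 'I_r.+1 -> V} :=
  [ffun i => if unlift ord_max i is Some j then g j else v].

Lemma extend_lift g v i : extend g v (lift ord_max i) = g i.
Proof. by rewrite ffunE liftK. Qed.

Lemma extend_max g v : extend g v ord_max = v.
Proof. by rewrite ffunE unlift_none. Qed.

Lemma card_extend (M : {set {ffun 'I_r.+1 -> V}}) :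
  #|M| = (\sum_g #|[set v | extend g v \in M]|)%N.
Proof.
pose D := [set p : {ffun 'I_r -> V} * V | extend p.1 p.2 \in M].
have inj : injective (fun p : {ffun 'I_r -> V} * V => extend p.1 p.2).
  move=> [g v] [g' v'] /= e; congr pair.
    by apply/ffunP => i; rewrite -(extend_lift g v) e extend_lift.
  by rewrite -(extend_max g v) e extend_max.
have eM : M = [set extend p.1 p.2 | p in D].
  apply/setP => h; apply/idP/imsetP => [hM|[p]]; last by rewrite inE => ? ->.
  have e : h = extend [ffun i => h (lift ord_max i)] (h ord_max).
    by apply/ffunP => i; rewrite ffunE; case: unliftP => [j|] -> //; rewrite ffunE.
  by exists ([ffun i => h (lift ord_max i)], h ord_max); rewrite // inE -e.
rewrite [in LHS]eM card_imset // -sum1_card.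
rewrite (eq_bigl (fun p => true && (extend p.1 p.2 \in M))); last first.
  by move=> p; rewrite inE.
rewrite -(pair_big_dep predT (fun g v => extend g v \in M) (fun _ _ => 1%N)) /=.
by apply: eq_bigr => g _; rewrite sum1dep_card.
Qed.

End Extension.
Arguments extend {V r}.

(** No graph enters, so the induction can run on arbitrary sets of tuples. *)
Definition grid {V : finType} {r m : nat} (M : {set {ffun 'I_r -> V}})
    (a : 'I_m -> {ffun 'I_r -> V}) : Prop :=
  [/\ forall k, a k \in M,
      forall i j k l, i != j ->
        exists2 h, h \in M & h i = a k i /\ h j = a l j
    & forall i, injective (fun k => a k i)].

(** Only pairs of prefix entries need a clause: a prefix entry and a vertex [v] of [T] already lie
    together in some [extend (a k) v]. *)
Definition fan {V : finType} {r m : nat} (M : {set {ffun 'I_r.+1 -> V}})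
    (a : 'I_m -> {ffun 'I_r -> V}) (T : {set V}) : Prop :=
  [/\ forall k v, v \in T -> extend (a k) v \in M,
      forall i j k l, i != j -> exists2 h, h \in M
        & h (lift ord_max i) = a k i /\ h (lift ord_max j) = a l j
    & forall i, injective (fun k => a k i)].

Lemma grid_of_fan (V : finType) (r m : nat) (M : {set {ffun 'I_r.+1 -> V}})
    (a : 'I_m -> {ffun 'I_r -> V}) (T : {set V}) (t : 'I_m -> V) :
  fan M a T -> injective t -> (forall k, t k \in T) ->
  grid M (fun k => extend (a k) (t k)).
Proof.
move=> [aM aP ainj] tinj tT; split.
- by move=> k; apply: aM.
- move=> i j k l; case: (unliftP ord_max i) => [i'|] ->;
    case: (unliftP ord_max j) => [j'|] ->; rewrite ?extend_lift ?extend_max ?eqxx //.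
  + by rewrite (inj_eq lift_inj) => /aP-/(_ k l).
  + move=> _; exists (extend (a k) (t l)); first exact: aM.
    by rewrite extend_lift extend_max.
  + move=> _; exists (extend (a l) (t k)); first exact: aM.
    by rewrite extend_lift extend_max.
- move=> i k l /=; case: (unliftP ord_max i) => [i'|] ->.
    by rewrite !extend_lift => /ainj.
  by rewrite !extend_max => /tinj.
Qed.

Lemma inj_into_set (T : finType) (A : {set T}) (m : nat) :
  (m <= #|A|)%N -> exists2 f : 'I_m -> T, injective f & forall k, f k \in A.
Proof.
move=> le; exists (fun k => enum_val (widen_ord le k)); last by move=> k; exact: enum_valP.
by move=> k l /enum_val_inj /(congr1 val) /= /val_inj.
Qed.

(** * From a grid of popular prefixes to a fan *)

Definition popular {R : realFieldType} {V : finType} {r : nat}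
    (M : {set {ffun 'I_r.+1 -> V}}) (x : R) : {set {ffun 'I_r -> V}} :=
  [set g | x * #|V|%:R <= #|[set v | extend g v \in M]|%:R].

(** Split [c] as [3 / 4 * c + c / 4]: the first summand is the threshold, the second the density of
    popular prefixes. *)
Lemma card_popular (R : realFieldType) (V : finType) (r : nat) (c : R)
    (M : {set {ffun 'I_r.+1 -> V}}) :
  (0 < #|V|)%N -> 0 < c -> c * #|V|%:R ^+ r.+1 <= #|M|%:R ->
  (c / 4) * #|V|%:R ^+ r <= #|popular M (3 / 4 * c)|%:R.
Proof.
move=> V0 c0 hM.
have e : #|{ffun 'I_r -> V}|%:R = #|V|%:R ^+ r :> R.
  by rewrite card_ffun card_ord natrX.
rewrite -e; apply: many_popular => //; first by lra.
rewrite -card_extend e -mulrA -exprSr.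
suff -> : 3 / 4 * c + c / 4 = c by [].
by field.
Qed.

(** Count pairs (vertex, grid tuple) whose extension is in [M]. Splitting [3 / 4 * c] as
    [c / 2 + c / 4] yields the set [U] of vertices extending at least [m] tuples each; pigeonhole
    over the [2 ^ m'] sets [N v] yields [T]. *)
Lemma fan_of_grid (R : realFieldType) (V : finType) (r m m' : nat) (c : R)
    (M : {set {ffun 'I_r.+1 -> V}}) (a : 'I_m' -> {ffun 'I_r -> V}) :
  (0 < #|V|)%N -> 0 < c -> (0 < m')%N -> m%:R <= c / 2 * m'%:R ->
  grid (popular M (3 / 4 * c)) a ->
  exists (b : 'I_m -> {ffun 'I_r -> V}) (T : {set V}),
    fan M b T /\ c / 4 * #|V|%:R <= 2 ^+ m' * #|T|%:R.
Proof.
move=> V0 c0 m'0 hm [aL aP ainj].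
pose E v k := extend (a k) v \in M.
pose N v := [set k | E v k].
pose U := [set v | c / 2 * m'%:R <= #|N v|%:R].
have n0 : 0 < #|V|%:R :> R by rewrite ltr0n.
have hU : c / 4 * #|V|%:R <= #|U|%:R.
  have := @many_popular R V 'I_m' E (c / 2) (c / 4).
  rewrite card_ord; apply => //; first by lra.
  have -> : (\sum_v #|[set k | E v k]|)%N = (\sum_k #|[set v | E v k]|)%N.
    transitivity (\sum_v \sum_k (E v k : nat))%N.
      by apply: eq_bigr => v _; rewrite -sum1dep_card big_mkcond; apply: eq_bigr => k _; case: (E v k).
    rewrite exchange_big /=; apply: eq_bigr => k _.
    by rewrite -sum1dep_card [RHS]big_mkcond; apply: eq_bigr => v _; case: (E v k).
  rewrite natr_sum; apply: (@le_trans _ _ (\sum_(k < m') (3 / 4 * c * #|V|%:R))).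
    rewrite sumr_const card_ord -[X in _ <= X]mulr_natr.
    suff -> : c / 2 + c / 4 = 3 / 4 * c by [].
    by field.
  by apply: ler_sum => k _; have := aL k; rewrite inE.
have U0 : (0 < #|U|)%N.
  rewrite -(ltr0n R); apply: lt_le_trans hU; rewrite mulr_gt0 //; lra.
have [S [hS S0]] := pigeonhole _ _ N _ U0.
set T := [set v in U | N v == S] in hS S0.
have [v0] := card_gt0P S0; rewrite !inE => /andP[v0U /eqP v0S].
have mS : (m <= #|S|)%N by rewrite -(ler_nat R) (le_trans hm) // -v0S.
have [f finj fS] := inj_into_set _ _ _ mS.
exists (a \o f), T; split; last first.
  apply: (le_trans hU); rewrite -natrX -natrM ler_nat (leq_trans hS) //.
  by rewrite -cardsT -powersetT card_powerset cardsT card_ord.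
split.
- move=> k v; rewrite inE => /andP[_ /eqP vS].
  by have := fS k; rewrite -vS inE.
(* The prefix joining the two entries is popular, hence has some extension in [M]. *)
- move=> i j k l /aP-/(_ (f k) (f l)) [g gL [gi gj]].
  have : (0 < #|[set v | extend g v \in M]|)%N.
    move: gL; rewrite inE -(ltr0n R); apply: lt_le_trans.
    by rewrite mulr_gt0 //; lra.
  move=> /card_gt0P[v]; rewrite inE => hv.
  by exists (extend g v); rewrite // !extend_lift.
- by move=> i k l /= /ainj /finj.
Qed.

(** * Numerical bounds *)

(** Take [m'] just above [2 * m / c]; rounding costs at most [c], which is at most [m / 2]. *)
Lemma ceil_ratio (R : archiRealFieldType) (m : nat) (c : R) :
  (0 < m)%N -> 0 < c -> c <= 1 / 2 ->
  exists m' : nat,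
    [/\ (0 < m')%N, m%:R <= c / 2 * m'%:R & c * m'%:R <= 5 / 2 * m%:R].
Proof.
move=> m0 c0 c2; pose x := 2 * m%:R / c.
have m1 : 1 <= m%:R :> R by rewrite ler1n.
have x0 : 0 <= x by rewrite divr_ge0 ?mulr_ge0 ?ler0n // ltW.
have xc : c * x = 2 * m%:R by rewrite /x mulrC divfK ?gt_eqF.
have /andP[h1 h2] := Num.Theory.truncn_itv x0.
exists (Num.truncn x).+1; split=> //.
  have : c * x <= c * (Num.truncn x).+1%:R by rewrite ler_pM2l // ltW.
  lra.
have : c * (Num.truncn x).+1%:R <= c * x + c.
  by rewrite -[X in _ + X]mulr1 -mulrDr ler_pM2l // -natr1 lerD2r.
lra.
Qed.

(** Already [(6 / 5) ^ 8 > 4]. The exponent fits the [5 / 2] of [ceil_ratio]: their product is 4. *)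
Lemma expR85_gt4 (R : realType) : 4 < expR (8 / 5 : R).
Proof.
have h : 1 + 1 / 5 <= expR (1 / 5 : R) by exact: expR_ge1Dx.
have -> : 8 / 5 = 1 / 5 * 8%:R :> R by field.
rewrite expRM_natr; apply: (@lt_le_trans _ _ ((1 + 1 / 5) ^+ 8)); first by lra.
by apply: lerXn2r; rewrite ?nnegrE ?expR_ge0 //; lra.
Qed.

Lemma double_le_exp2 (m : nat) : (0 < m)%N -> (2 * m <= 2 ^ m)%N.
Proof. by case: m => // m _; rewrite expnS leq_mul2l /= ltn_expl. Qed.

(* A grid of size m of tuples of length r + 1 needs ln n >= K m with
   K = 2^(r(r+1)+1) / c^r; passing to prefixes turns c into c / 4 and m into
   at most 4m / c, and K is the solution of this recursion. *)
Lemma budget_step (R : realFieldType) (r m m' : nat) (c L : R) :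
  0 < c -> c * m'%:R <= 4 * m%:R ->
  m%:R * 2 ^+ (r.+1 * r.+2).+1 <= c ^+ r.+1 * L ->
  m'%:R * 2 ^+ (r * r.+1).+1 <= (c / 4) ^+ r * L.
Proof.
move=> c0 m'm hm.
rewrite -(ler_pM2l c0) mulrA.
apply: (@le_trans _ _ (4 * m%:R * 2 ^+ (r * r.+1).+1)).
  by rewrite ler_pM2r ?exprn_gt0.
have p0 : 0 < 4 ^+ r :> R by rewrite exprn_gt0.
rewrite -(ler_pM2l p0); apply: le_trans (le_trans hm _); last first.
  rewrite expr_div_n le_eqVlt; apply/orP; left; apply/eqP; rewrite exprS.
  by field; rewrite gt_eqF.
have -> : (r.+1 * r.+2).+1 = ((r * r.+1).+1 + 2 * r + 2)%N by lia.
rewrite 2!exprD (exprM _ 2 r) -[2 ^+ 2]/(2 * 2).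
have -> : 2 * 2 = 4 :> R by ring.
rewrite le_eqVlt; apply/orP; left; apply/eqP; ring.
Qed.

(** * Existence of grids, by induction on the tuple length *)

Lemma grid_exists (R : realType) (V : finType) (r m : nat) (c : R)
    (M : {set {ffun 'I_r.+1 -> V}}) :
  (0 < #|V|)%N -> 0 < c -> c <= 1 / 2 ->
  c * #|V|%:R ^+ r.+1 <= #|M|%:R ->
  m%:R * 2 ^+ (r * r.+1).+1 <= c ^+ r * ln #|V|%:R ->
  ln #|V|%:R <= 2 * (c / 4 ^+ r) * #|V|%:R ->
  exists a : 'I_m -> {ffun 'I_r.+1 -> V}, grid M a.
Proof.
move=> V0; elim: r m c M => [|r IH] m c M c0 c2 hM hm hn.
  have mM : (m <= #|M|)%N.
    rewrite -(ler_nat R); move: hM hm hn.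
    rewrite !expr1 expr0 mul1r divr1; lra.
  have [a ainj aM] := inj_into_set _ _ _ mM.
  exists a; split=> // [i j k l|i k l e]; first by rewrite !ord1 eqxx.
  by apply: ainj; apply/ffunP => j; rewrite (ord1 j) -(ord1 i).
have [->|m0] := posnP m.
  by exists (fun _ => [ffun _ => enum_val (Ordinal V0)]); split=> [[]|i j []|i []] //.
have [m' [m'0 mm' m'm]] := ceil_ratio _ _ _ m0 c0 c2.
have n0 : 0 < #|V|%:R :> R by rewrite ltr0n.
have c4 : 0 < c / 4 by lra.
have m'n : m'%:R * 2 ^+ (r * r.+1).+1 <= (c / 4) ^+ r * ln (#|V|%:R : R).
  apply: (budget_step _ _ m) => //; apply: (le_trans m'm).
  have : 0 <= m%:R :> R by []. lra.
have [a ha] : exists a : 'I_m' -> _, grid (popular M (3 / 4 * c)) a.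
  apply: (IH m' (c / 4)) => //.
  - lra.
  - exact: card_popular.
  - suff -> : c / 4 / 4 ^+ r = c / 4 ^+ r.+1 by [].
    by rewrite exprS; field; rewrite expf_neq0.
have [b [T [hf hT]]] := fan_of_grid _ _ _ _ _ _ _ _ V0 c0 m'0 mm' ha.
(* The budget gives [2 * m' <= ln n], and [8 / 5 < 2]. *)
have n4 : 4 ^+ m' <= #|V|%:R :> R.
  rewrite -[leRHS]lnK ?posrE //.
  apply: (@le_trans _ _ (expR (8 / 5) ^+ m')).
    by apply: lerXn2r; rewrite ?nnegrE ?expR_ge0 // ltW // expR85_gt4.
  rewrite -expRM_natr ler_expR -mulr_natr.
  have c41 : (c / 4) ^+ r <= 1 by apply: exprn_ile1; lra.
  have l0 : 0 <= ln (#|V|%:R : R) by rewrite ln_ge0 // ler1n.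
  have e1 : (c / 4) ^+ r * ln #|V|%:R <= 1 * ln #|V|%:R by rewrite ler_wpM2r.
  have e2 : m'%:R * 2 <= m'%:R * 2 ^+ (r * r.+1).+1 :> R.
    by rewrite ler_pM2l ?ltr0n // exprS ler_peMr // exprn_ege1 // ler1n.
  have : 0 <= m'%:R :> R by []. lra.
(* Since [m <= c / 2 * m' <= c / 4 * 2 ^+ m'], a further factor [2 ^+ m'] is bounded through [n4]
   and [hT]. *)
have mT : (m <= #|T|)%N.
  rewrite -(ler_nat R) -(ler_pM2l (_ : 0 < 2 ^+ m')) ?exprn_gt0 //.
  apply: le_trans hT; apply: (@le_trans _ _ (c / 4 * 4 ^+ m')); last by rewrite ler_pM2l.
  have -> : 4 ^+ m' = 2 ^+ m' * 2 ^+ m' :> R by rewrite -exprMn; congr (_ ^+ _); ring.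
  rewrite mulrCA ler_pM2l ?exprn_gt0 //.
  apply: (le_trans mm').
  have : (2 * m')%:R <= (2 ^ m')%:R :> R by rewrite ler_nat double_le_exp2.
  rewrite natrM natrX => h.
  have : c / 4 * (2 * m'%:R) <= c / 4 * 2 ^+ m' by rewrite ler_pM2l.
  lra.
have [t tinj tT] := inj_into_set _ _ _ mT.
by exists (fun k => extend (b k) (t k)); exact: grid_of_fan hf tinj tT.
Qed.

(** * The classes of a fan: induced type and covering *)

Definition fan_class {V : finType} {r m : nat}
    (a : 'I_m -> {ffun 'I_r -> V}) (T : {set V}) (i : 'I_r.+1) : {set V} :=
  if unlift ord_max i is Some j then [set a k j | k : 'I_m] else T.

Lemma fan_class_lift (V : finType) (r m : nat) (a : 'I_m -> {ffun 'I_r -> V})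
    (T : {set V}) i : fan_class a T (lift ord_max i) = [set a k i | k : 'I_m].
Proof. by rewrite /fan_class liftK. Qed.

Lemma fan_class_max (V : finType) (r m : nat) (a : 'I_m -> {ffun 'I_r -> V})
    (T : {set V}) : fan_class a T ord_max = T.
Proof. by rewrite /fan_class unlift_none. Qed.

Lemma val_lift_max (r : nat) (i : 'I_r) : (val (lift ord_max i) == r) = false.
Proof. by apply: ltn_eqF; have := ltn_ord i; rewrite -[X in (X < _)%N]lift_max. Qed.

Section FanCovers.
Variables (V : finType) (r m : nat).
Variables (eH : rel 'I_r.+1) (eG : rel V) (M : {set {ffun 'I_r.+1 -> V}}).
Variables (a : 'I_m -> {ffun 'I_r -> V}) (T : {set V}).
Hypotheses (MH : M \subset HG eH eG) (fanMaT : fan M a T).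

Let X := fan_class a T.

Lemma mem_ind_emb h : h \in M ->
  injective h /\ forall i j, i != j -> eG (h i) (h j) = eH i j.
Proof.
move=> /(fintype.subsetP MH); rewrite inE => /andP[/injectiveP hinj /forallP hE].
split=> // i j ij; have /forallP/(_ j) := hE i.
by rewrite ij => /eqP.
Qed.

(** The key link: disjointness, adjacency and covered edges between two classes are all read off one
    member of [M]. *)
Lemma fan_class_pair i j x y : i != j -> x \in X i -> y \in X j ->
  exists2 h, h \in M & h i = x /\ h j = y.
Proof.
have [aM aP _] := fanMaT; rewrite /X.
case: (unliftP ord_max i) => [i'|] ->; case: (unliftP ord_max j) => [j'|] ->;
  rewrite ?fan_class_lift ?fan_class_max ?eqxx // ?(inj_eq lift_inj).
- by move=> ij /imsetP[k _ ->] /imsetP[l _ ->]; exact: aP.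
- move=> _ /imsetP[k _ ->] yT; exists (extend (a k) y); first exact: aM.
  by rewrite extend_lift extend_max.
- move=> _ xT /imsetP[k _ ->]; exists (extend (a k) x); first exact: aM.
  by rewrite extend_lift extend_max.
Qed.

Lemma fan_class_disjoint i j : i != j -> [disjoint X i & X j].
Proof.
move=> ij; rewrite disjoint_subset; apply/fintype.subsetP => x xi; rewrite inE.
apply/negP => xj; have [h hM [hi hj]] := fan_class_pair i j x x ij xi xj.
have [hinj _] := mem_ind_emb h hM.
by move: ij; rewrite (hinj i j) ?eqxx // hi.
Qed.

Lemma fan_induced :
  induced_of_type eH eG X (fun i => if val i == r then #|T| else m).
Proof.
have [aM aP ainj] := fanMaT; split=> [i|]; last split.
- rewrite /X; case: (unliftP ord_max i) => [i'|] ->.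
    rewrite fan_class_lift card_imset ?card_ord; last exact: ainj.
    by rewrite val_lift_max.
  by rewrite fan_class_max eqxx.
- exact: fan_class_disjoint.
- move=> i j ij x y xi yj; have [h hM [<- <-]] := fan_class_pair i j x y ij xi yj.
  by have [_ ->] := mem_ind_emb h hM.
Qed.

Lemma fan_covers : (0 < r)%N -> covers eH eG M X.
Proof.
move=> r0; split=> [i j ij x y xi yj exy|].
  have [h hM [hi hj]] := fan_class_pair i j x y ij xi yj.
  exists h => //; exists i, j; split; last by left.
  by have [_ <- //] := mem_ind_emb h hM; rewrite hi hj.
have [aM aP ainj] := fanMaT; have [cX _] := fan_induced.
have leX i : (min_class X <= #|X i|)%N.
  rewrite /min_class; move: (mem_index_enum i).
  elim: (index_enum _) => // j s IHs; rewrite inE big_cons geq_min.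
  by move=> /orP[/eqP <-|/IHs ->]; rewrite ?leqnn ?orbT.
(* As [0 < r], some class other than the last exists, and it has size [m]. *)
have lem : (min_class X <= m)%N.
  by have := leX (lift ord_max (Ordinal r0)); rewrite cX val_lift_max.
have [t tinj tT] : exists2 t : 'I_(min_class X) -> V, injective t & forall k, t k \in T.
  by apply: inj_into_set; have := leX ord_max; rewrite cX eqxx.
pose b k := extend (a (widen_ord lem k)) (t k).
have bX k i : b k i \in X i.
  rewrite /b /X; case: (unliftP ord_max i) => [i'|] ->.
    by rewrite extend_lift fan_class_lift; apply/imsetP; exists (widen_ord lem k).
  by rewrite extend_max fan_class_max.
have binj i k l : b k i = b l i -> k = l.
  rewrite /b; case: (unliftP ord_max i) => [i'|] ->.
    by rewrite !extend_lift => /ainj /(congr1 val) /= /val_inj.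
  by rewrite !extend_max => /tinj.
exists b; split; first by move=> k; exact: aM.
split=> [k l kl|k i]; last by exists i.
(* A common vertex at equal indices contradicts [binj], at different indices the disjointness of
   classes. *)
rewrite disjoint_subset; apply/fintype.subsetP => x /codomP[i ->]; rewrite inE.
apply/negP => /codomP[j e]; have [ij|ij] := eqVneq i j.
  by move: kl; rewrite ij in e; rewrite (binj _ _ _ e) eqxx.
have := disjointFr (fan_class_disjoint i j ij) (bX k i).
by rewrite e bX.
Qed.

End FanCovers.

Theorem theorem3 (R : realType) (r : nat) (c : R) (V : finType)
  (eH : rel 'I_r) (eG : rel V) (M : {set {ffun 'I_r -> V}}) :
  (2 <= r)%N -> 0 < c -> c <= 1 / 2 ->
  symmetric eH -> irreflexive eH ->
  symmetric eG -> irreflexive eG ->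
  (0 < #|V|)%N ->
  M \subset HG eH eG ->
  c * (#|V|%:R) ^+ r <= (#|M|%:R : R) ->
  let n : R := #|V|%:R in
  let s : nat := `|Num.floor (c ^+ (r ^ 2) * ln n)|%N in
  exists (t : nat) (X : 'I_r -> {set V}),
    n `^ (1 - c ^+ (r - 1)) < t%:R /\
    induced_of_type eH eG X (fun i => if val i == r.-1 then t else s) /\
    covers eH eG M X.
Proof.
case: r eH M => [|[|r]] // eH M _ c0 c2 _ _ _ _ V0 MH hM n s.
have n0 : 0 < n by rewrite ltr0n.
(* [M] has a member, which injects at least two vertices into [V]. *)
have n1 : 1 < n.
  rewrite ltr1n ltnNge; apply/negP => V1.
  have : (0 < #|M|)%N.
    by rewrite -(ltr0n R); apply: lt_le_trans hM; rewrite mulr_gt0 ?exprn_gt0.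
  move=> /card_gt0P[h hM']; have [hinj _] := mem_ind_emb _ _ _ _ _ MH h hM'.
  by have := leq_trans (leq_card h hinj) V1; rewrite card_ord.
have c1 : c <= 1 by lra.
have cge0 := ltW c0.
have l0 : 0 < ln n by rewrite ln_gt0.
have powE : n `^ (1 - c ^+ (r.+2 - 1)) = n * expR (- (c ^+ r.+1 * ln n)).
  by rewrite subn1 /= /powR gt_eqF // mulrBl mul1r expRD lnK.
rewrite powE.
suff [a [T [hf hT]]] : exists (a : 'I_s -> {ffun 'I_r.+1 -> V}) (T : {set V}),
    fan M a T /\ n * expR (- (c ^+ r.+1 * ln n)) < #|T|%:R.
  exists #|T|, (fan_class a T); split=> //; split; first exact: fan_induced MH hf.
  exact: fan_covers MH hf _.
(* For [s = 0], all of [V] serves as [T]. *)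
have [->|s0] := posnP s.
  exists (fun _ => [ffun _ => enum_val (Ordinal V0)]), [set: V].
  split; first by split=> [[]|i j []|i []] //.
  rewrite cardsT -/n -[ltRHS]mulr1 ltr_pM2l // expR_lt1 oppr_lt0.
  by rewrite mulr_gt0 // exprn_gt0.
have hs : s%:R <= c ^+ (r.+2 ^ 2) * ln n.
  have x0 : 0 <= c ^+ (r.+2 ^ 2) * ln n by rewrite mulr_ge0 ?exprn_ge0 ?ltW.
  rewrite /s natr_absz ger0_norm ?floor_ge0 //.
  exact: Num.Theory.floor_le.
have [m' [m'0 mm' m'm]] := ceil_ratio _ _ _ s0 c0 c2.
have s1 : 1 <= s%:R :> R by rewrite ler1n.
have [a ha] : exists a : 'I_m' -> _, grid (popular M (3 / 4 * c)) a.
  apply: (grid_exists R _ _ _ (c / 4)) => //; [lra | lra | exact: card_popular | |].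
  - apply: (budget_step _ _ s) => //; first by lra.
    (* The exponent in [s] splits as [r.+1 + e]: [c ^+ r.+1] meets the budget and [c ^+ e] absorbs
       its factor [2 ^+ e]. *)
    set e := (r.+1 * r.+2).+1.
    have he : (r.+2 ^ 2 = r.+1 + e)%N by rewrite -mulnn /e; clear -r; lia.
    have c2e : (c * 2) ^+ e <= 1 by apply: exprn_ile1; lra.
    apply: (@le_trans _ _ (c ^+ r.+1 * (c * 2) ^+ e * ln n)).
      have -> : c ^+ r.+1 * (c * 2) ^+ e * ln n = c ^+ (r.+2 ^ 2) * ln n * 2 ^+ e.
        by rewrite he exprD exprMn; ring.
      by rewrite ler_pM2r ?exprn_gt0.
    by rewrite ler_pM2r // ler_piMr // exprn_ge0.
  (* As [s >= 1], [ln n] is so large that [c * ln n >= 8 * 4 ^+ r]; combine this with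
     [n >= (ln n / 2) ^ 2]. *)
  - have sqL : (ln n / 2) * (ln n / 2) <= n.
      have h : ln n / 2 <= expR (ln n / 2).
        by apply: le_trans (expR_ge1Dx _); rewrite lerDr.
      rewrite -[leRHS]lnK ?posrE // [in leRHS](splitr (ln n)) expRD.
      by apply: ler_pM => //; lra.
    have h1 : 1 <= c ^+ (2 * r + 4) * ln n.
      apply: (le_trans s1); apply: (le_trans hs); rewrite ler_pM2r //.
      by apply: ler_wiXn2l => //; rewrite -mulnn; clear -r; lia.
    have p0 : 0 < 4 ^+ r :> R by rewrite exprn_gt0.
    have h2 : c ^+ (2 * r + 4) * (8 * 4 ^+ r) <= c.
      have -> : 8 * 4 ^+ r = 2 ^+ (2 * r + 3) :> R.
        rewrite exprD (exprM _ 2 r) mulrC.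
        have -> : 2 ^+ 2 = 4 :> R by ring.
        by congr (_ * _); ring.
      rewrite addnS exprS -mulrA -exprMn -[leRHS]mulr1 ler_pM2l //.
      by apply: exprn_ile1; lra.
    have h3 : 8 * 4 ^+ r <= c * ln n.
      have := ler_wpM2r (ltW l0) h2; apply: le_trans.
      rewrite mulrAC ler_peMl // mulr_ge0 // ltW //.
    have -> : 2 * (c / 4 / 4 ^+ r) * n = (c / 4 ^+ r * 2) * n / 4 by field; rewrite gt_eqF.
    rewrite -(ler_pM2l p0).
    have -> : 4 ^+ r * (c / 4 ^+ r * 2 * n / 4) = c / 2 * n by field; rewrite gt_eqF.
    apply: (@le_trans _ _ (c / 2 * ((ln n / 2) * (ln n / 2)))).
      have -> : c / 2 * ((ln n / 2) * (ln n / 2)) = c * ln n / 8 * ln n by field.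
      by rewrite ler_pM2r //; lra.
    by rewrite ler_pM2l //; lra.
have [b [T [hf hT]]] := fan_of_grid _ _ _ _ _ _ _ _ V0 c0 m'0 mm' ha.
exists b, T; split=> //.
set y := c ^+ r.+1 * ln n.
(* After multiplication by [c], the exponent [8 / 5 * m'] becomes at most [4 * s]; two factors [c]
   of the bound on [s] absorb the 4, and [r.+2] others give [c * y]. *)
have h4 : 4 ^+ m' < expR y.
  apply: (@lt_le_trans _ _ (expR (8 / 5) ^+ m')).
    by rewrite ltr_pXn2r ?nnegrE ?expR_ge0 // expR85_gt4.
  rewrite -expRM_natr ler_expR.
  rewrite -(ler_pM2l c0); apply: (@le_trans _ _ (4 * s%:R)); first by lra.
  have : 4 * s%:R <= 4 * (c ^+ (r.+2 ^ 2) * ln n) by rewrite ler_pM2l.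
  move/le_trans; apply.
  have -> : (r.+2 ^ 2 = (r * r + 3 * r) + 2 + r.+2)%N by rewrite -mulnn; clear -r; lia.
  rewrite (exprD _ (_ + _)%N) (exprD _ (r * r + 3 * r)) /y.
  have -> : c * (c ^+ r.+1 * ln n) = 1 * (c ^+ r.+2 * ln n) by rewrite (exprS c r.+1) mul1r mulrA.
  have p1 : 0 < c ^+ r.+2 * ln n by rewrite mulr_gt0 // exprn_gt0.
  rewrite -[X in _ * X <= _]mulrA [leLHS]mulrA (ler_pM2r p1).
  have : c ^+ (r * r + 3 * r) <= 1 by exact: exprn_ile1.
  have : 0 <= c ^+ (r * r + 3 * r) by exact: exprn_ge0.
  have : c ^+ 2 <= (1 / 2) ^+ 2 by apply: lerXn2r; rewrite ?nnegrE //; lra.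
  have : 0 <= c ^+ 2 by exact: exprn_ge0.
  nra.
have hc : 1 <= c / 4 * 2 ^+ m'.
  have : (2 * m')%:R <= (2 ^ m')%:R :> R by rewrite ler_nat double_le_exp2.
  rewrite natrM natrX => h.
  have : c / 4 * (2 * m'%:R) <= c / 4 * 2 ^+ m' by rewrite ler_pM2l //; lra.
  lra.
(* One [2 ^+ m'] pays for the pigeonhole, the other for the factor [c / 4]. *)
have nT : n <= 4 ^+ m' * #|T|%:R.
  have -> : 4 ^+ m' = 2 ^+ m' * 2 ^+ m' :> R by rewrite -exprMn; congr (_ ^+ _); ring.
  apply: (@le_trans _ _ (2 ^+ m' * (c / 4 * n))).
    by rewrite mulrA [_ * (c / 4)]mulrC ler_peMl // ltW.
  by rewrite -[leRHS]mulrA ler_pM2l // exprn_gt0.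
have T0 : 0 < #|T|%:R :> R.
  by rewrite -(pmulr_rgt0 _ (_ : 0 < 4 ^+ m')) ?exprn_gt0 //; exact: lt_le_trans nT.
rewrite expRN ltr_pdivrMr ?expR_gt0 //; apply: (le_lt_trans nT).
by rewrite mulrC ltr_pM2l.
Qed.
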